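(* Let $G=(V,E)$, $V=[n]$, be a digraph without loops and parallel arcs, let $(B,L,U)\in\Gamma(G)$ be an ultimate basis with $B=A\cup Y$ ($A\subseteq E$, $Y\subseteq V\setminus\{1\}$), and let $A_1,A_2\subseteq A$ denote the sets of thick and thin arcs with respect to $B$, respectively. Then: (i) $A=A_1\cup A_2$; (ii) $A_1$ forms a spanning collection of node-disjoint directed cycles (i.e. every node of $V$ lies on exactly one of these cycles); (iii) for every $i\in V\setminus\{1\}$, the digraph with arc set $A_1\cup A_2$ contains a directed path from node $1$ to node $i$; (iv) $|L|\leq(n-1)/2$ and $|U|\leq(n-1)/2$.
   Context: $G=(V,E)$ is a digraph without loops and parallel arcs on $V=[n]$, $n\geq2$; $N^-(i)=\{j:(j,i)\in E\}$, $N^+(i)=\{j:(i,j)\in E\}$. For $\beta\in(0,1)$, $\mathcal{WH}_\beta(G)$ is the set of all $(x,y)\in\mathbb R^{E}\times\mathbb R^{V\setminus\{1\}}$ with (1) $\sum_{j\in N^+(1)}x_{1j}-\beta\sum_{j\in N^-(1)}x_{j1}=1-\beta^n$; (2) $\sum_{j\in N^+(i)}x_{ij}-\beta\sum_{j\in N^-(i)}x_{ji}=0$ for $i\in V\setminus\{1\}$; (3) $\sum_{j\in N^+(1)}x_{1j}=1$; (4) $\sum_{j\in N^+(i)}x_{ij}-y_i=\beta^{n-1}$ for $i\in V\setminus\{1\}$; (5) $0\leq y_i\leq\beta-\beta^{n-1}$ for $i\in V\setminus\{1\}$; (6) $x_{ij}\geq0$ for $(i,j)\in E$. A basis is a triple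 $(B,L,U)$ where $B=A\cup Y$, $A\subseteq E$ (basic $x$-variables), $Y\subseteq V\setminus\{1\}$ (basic $y$-variables), $|A|+|Y|=2n$, $L\cup U$ is a partition of $V\setminus(\{1\}\cup Y)$ (parts possibly empty), and the $2n\times2n$ submatrix of the coefficient matrix of (1)–(4) with columns $B$ is invertible. Its basic solution is the unique solution of (1)–(4) with $x_{ij}=0$ for $(i,j)\in E\setminus A$, $y_i=0$ for $i\in L$, $y_i=\beta-\beta^{n-1}$ for $i\in U$; the basis is feasible if this solution satisfies (5),(6). $\Gamma(G,\beta)$ is the set of feasible bases. There is $\alpha^*\in(0,1)$ such that $\Gamma(G,\beta)=\Gamma(G,\alpha^* )$ for all $\beta\in[\alpha^*,1)$; this common set is denoted $\Gamma(G)$ and its elements are called ultimate bases. Write $\beta=1-\delta$; asymptotic notation refers to $\delta\to0^+$ with $G$ and $(B,L,U)$ fixed. Let $x=x(\beta)$ be the $x$-part of the basic solution of $(B,L,U)\in\Gamma(G)$. An arc $(i,j)\in A$ is thick with respect to $B$ if $x_{ij}=1-O(\delta)$ (i.e. $|x_{ij}-1|\leq C\delta$ for some constant $C$ and all small $\delta>0$), and thin with respect to $B$ if $x_{ij}=O(\delta)$. *)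

(* Defs.v *)
From HB Require Import structures.
From mathcomp Require Import all_boot all_order all_algebra.
From mathcomp Require Import all_classical all_reals all_analysis.
Import Order.TTheory GRing.Theory Num.Theory.
Import numFieldNormedType.Exports.

Set Implicit Arguments.
Unset Strict Implicit.
Unset Printing Implicit Defensive.

Local Open Scope ring_scope.

(* The node set V = {1, ..., n} is 'I_n with n = n'.+1, so that node 1 of the
   informal numbering is ord0.  A digraph without parallel arcs on V is a
   relation on 'I_n (antiparallel pairs (i,j), (j,i) are allowed); absence of
   loops is irreflexivity of the relation. *)

(* The data (B, L, U), with B = A \cup Y split into its x- and y-variables. *)
Record basis_data (n' : nat) := BasisData {
  basicA : {set 'I_n'.+1 * 'I_n'.+1};
  basicY : {set 'I_n'.+1};
  atL : {set 'I_n'.+1};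
  atU : {set 'I_n'.+1}
}.

Section WeightedHamiltonian.
Context {R : realType} {n' : nat}.
Local Notation n := n'.+1.
Local Notation V := 'I_n.
Implicit Types (G : rel V) (beta : R) (b : basis_data n').

(* Vectors of R^E x R^(V \ {1}) are represented by total functions; the
   coordinates outside E and at ord0 occur in no constraint below, except that
   basic solutions set them to 0. *)
Implicit Types (x : {ffun V * V -> R}) (y : {ffun V -> R}).

Definition out_sum G x (i : V) : R := \sum_(j | G i j) x (i, j).
Definition in_sum G x (i : V) : R := \sum_(j | G j i) x (j, i).

Definition WH_equations G beta x y : Prop :=
  [/\ out_sum G x ord0 - beta * in_sum G x ord0 = 1 - beta ^+ n,
      forall i, i != ord0 -> out_sum G x i - beta * in_sum G x i = 0,
      out_sum G x ord0 = 1
    & forall i, i != ord0 -> out_sum G x i - y i = beta ^+ n.-1].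

Definition WH_bounds G beta x y : Prop :=
  (forall i, i != ord0 -> 0 <= y i <= beta - beta ^+ n.-1) /\
  (forall i j, G i j -> 0 <= x (i, j)).

(* The columns in B = A \cup Y of the coefficient matrix of WH_equations.  The
   upper n rows are the equations involving beta * in_sum at each k : V, the
   lower n rows those fixing out_sum at ord0 and out_sum - y elsewhere; the left
   columns are those of the x-variables in A, the right columns those of the
   y-variables in Y.  It is used only for Y not containing ord0. *)
Definition basis_mx beta (A : {set V * V}) (Y : {set V}) :
    'M[R]_(n + n, #|A| + #|Y|) :=
  block_mx
    (\matrix_(k < n, a < #|A|)
       ((k == (enum_val a).1)%:R - beta * (k == (enum_val a).2)%:R))
    0
    (\matrix_(k < n, a < #|A|) (k == (enum_val a).1)%:R)
    (\matrix_(k < n, i < #|Y|) - (k == enum_val i)%:R).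

Definition is_basis G beta b : Prop :=
  [/\ forall i j, (i, j) \in basicA b -> G i j,
      basicY b \subset [set~ ord0],
      atL b :|: atU b = ~: (ord0 |: basicY b),
      [disjoint atL b & atU b]
    & exists sz : (#|basicA b| + #|basicY b| = n + n)%N,
        castmx (erefl, sz) (basis_mx beta (basicA b) (basicY b)) \in unitmx].

Definition is_basic_solution G beta b
    (xy : {ffun V * V -> R} * {ffun V -> R}) : Prop :=
  [/\ WH_equations G beta xy.1 xy.2,
      forall a, a \notin basicA b -> xy.1 a = 0,
      forall i, i \in ord0 |: atL b -> xy.2 i = 0
    & forall i, i \in atU b -> xy.2 i = beta - beta ^+ n.-1].

(* The unique basic solution when b is a basis at beta, and 0 if there is
   none. *)
Definition basic_solution G beta b : {ffun V * V -> R} * {ffun V -> R} :=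
  xget ([ffun=> 0], [ffun=> 0]) (is_basic_solution G beta b).

Definition feasible_bases G beta : set (basis_data n') :=
  [set b | is_basis G beta b /\
           WH_bounds G beta (basic_solution G beta b).1
                            (basic_solution G beta b).2]%classic.

Definition stable_from G (alpha : R) : Prop :=
  0 < alpha < 1 /\
  forall beta, alpha <= beta < 1 ->
    feasible_bases G beta = feasible_bases G alpha.

(* Any two alpha with stable_from G alpha give the same set feasible_bases G
   alpha, so the choice of alpha does not matter. *)
Definition ultimate_bases G : set (basis_data n') :=
  [set b | exists2 alpha : R, stable_from G alpha
                            & feasible_bases G alpha b]%classic.

Definition thick G b (a : V * V) : Prop :=
  exists C : R, \forall d \near ((0 : R)^'+)%classic,
    `|(basic_solution G (1 - d) b).1 a - 1| <= C * d.

Definition thin G b (a : V * V) : Prop :=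
  exists C : R, \forall d \near ((0 : R)^'+)%classic,
    `|(basic_solution G (1 - d) b).1 a| <= C * d.

Definition thick_arcs G b : {set V * V} :=
  [set a in basicA b | `[< thick G b a >]].

Definition thin_arcs G b : {set V * V} :=
  [set a in basicA b | `[< thin G b a >]].

End WeightedHamiltonian.

Arguments ultimate_bases R {n'} G.
Arguments thick_arcs R {n'} G b.
Arguments thin_arcs R {n'} G b.

(* The arcs of the directed cycle visiting the nodes of c in cyclic order. *)
Definition cycle_arcs (T : finType) (c : seq T) : {set T * T} :=
  [set (v, next c v) | v in c].

Definition spanning_disjoint_cycles (T : finType) (S : {set T * T}) : Prop :=
  exists cs : seq (seq T),
    [/\ all (fun c => 1 < size c)%N cs,
        uniq (flatten cs),
        forall v : T, v \in flatten cs
      & S = \bigcup_(c <- cs) cycle_arcs c].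

(* Main.v *)
From HB Require Import structures.
Require Import Defs.
From mathcomp Require Import all_boot all_order all_algebra.
From mathcomp Require Import all_classical all_reals all_analysis.
From mathcomp Require Import lra ring.
Import numFieldNormedType.Exports.
Import Order.TTheory GRing.Theory Num.Theory.
Set Implicit Arguments.
Unset Strict Implicit.
Unset Printing Implicit Defensive.
Local Open Scope ring_scope.

(** Why the theorem holds. Split each node into an out-copy and an in-copy and
    read an arc (i, j) as an edge from the out-copy of i to the in-copy of j;
    the flow into or out of a node is then the sum of x over the edges at one
    copy. If some nonzero z supported on A had all these sums zero, then (z,
    0) would be in the kernel of the basis matrix, whatever beta is. So the
    edges of A are linearly independent (line_free), in other words they form
    a forest.

    Independence gives a left inverse that does not depend on beta and that
    recovers x from its 2n sums. The constraints place each of these sums in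
    [beta^(n-1), 1], that is at distance O(delta) from 1, so x(beta) = s +
    O(delta) for a fixed s (line_free_recovery). The limit s is nonnegative,
    is supported on A and has all sums equal to 1, that is, s is doubly
    stochastic. In a forest such a vector is 0/1 (line_free_integral): each
    copy meeting a fractional edge meets two of them, so the fractional edges
    are at least as many as the copies they meet, which is more than
    independence allows. Hence s is the matrix of a permutation of the nodes.
    Arcs with s = 1 are thick and arcs with s = 0 are thin, which is (i), and
    the cycles of the permutation are those of (ii).

    (iii) needs only one feasible beta < 1. If Z is the set of nodes that
    cannot be reached from node 1, the flow entering Z comes from Z, so the
    outflow of Z is at most beta times itself although it is positive
    (feasible_reach).

    (iv) Adding up the conservation equations shows that the outflows of the
    nodes other than 1 add up to beta + ... + beta^(n-1), while each of them
    lies between beta^(n-1), its value on L, and beta, its value on U. To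
    first order in delta, the n-1 deficits 1 - outflow thus lie between delta
    and (n-1) delta and have average n delta / 2, the midpoint; so at most
    half of them are at each end. For n = 2 the two ends coincide and this
    says nothing, but then L and U are empty because a basis has a basic
    y-variable (basis_nonbasic_le). *)

(** * Dependent and independent families of vectors *)

(** Linear independence as the existence of a left inverse: the coefficients z
    are fixed linear combinations of the coordinates of \sum_a z a * w a, and
    this turns bounds on those coordinates into bounds on z. *)
Lemma free_family_coordinates (F : fieldType) (T K : finType) (A : {set T})
    (w : T -> K -> F) :
  (forall z : T -> F,
     (forall k, \sum_(a in A) z a * w a k = 0) -> {in A, forall a, z a = 0}) ->
  exists c : T -> K -> F, forall z : T -> F,
    {in A, forall a, z a = \sum_k c a k * \sum_(a' in A) z a' * w a' k}.
Proof.
move=> free.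
pose N : 'M[F]_(#|A|, #|K|) := \matrix_(p, q) w (enum_val p) (enum_val q).
have Nfree : row_free N.
  rewrite -kermx_eq0; apply/eqP/row_matrixP => r; rewrite row0.
  set u := row r _.
  have uN0 : u *m N = 0 by rewrite -row_mul mulmx_ker row0.
  pose z a := \sum_(p | enum_val p == a) u 0 p.
  have zE p : z (enum_val p) = u 0 p.
    rewrite /z (big_pred1 p) // => q; exact: (inj_eq enum_val_inj).
  apply/rowP => p; rewrite -zE [RHS]mxE; apply: free; last exact: enum_valP.
  move=> k; rewrite [LHS]big_enum_val /=.
  have := congr1 (fun M : 'rV_ _ => M 0 (enum_rank k)) uN0.
  rewrite !mxE => E; rewrite -[RHS]E; apply: eq_bigr => q _.
  by rewrite zE !mxE enum_rankK.
pose P := pinvmx N.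
exists (fun a k => \sum_(p | enum_val p == a) P (enum_rank k) p) => z a aA.
pose zv : 'rV[F]_#|A| := \row_p z (enum_val p).
have := mulmxKp Nfree zv.
move=> /(congr1 (fun M : 'rV_ _ => M 0 (enum_rank_in aA a))).
rewrite [in X in _ = X -> _]mxE enum_rankK_in // => <-; rewrite mxE.
rewrite (reindex_onto enum_rank enum_val) /=; last first.
  by move=> ? _; rewrite enum_valK.
rewrite (eq_bigl xpredT); last by move=> k; rewrite enum_rankK eqxx.
apply: eq_bigr => k _; rewrite mulrC; congr (_ * _); last first.
  rewrite big_enum_val mxE; apply: eq_bigr => p _.
  by rewrite !mxE enum_rankK.
rewrite (big_pred1 (enum_rank_in aA a)) // => p /=.
by rewrite -{1}(enum_rankK_in aA aA) (inj_eq enum_val_inj).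
Qed.

(** With C at most as large as A, independence could hold only for a square
    invertible matrix; a nonzero kernel vector v on the side of C excludes
    this case as well. *)
Lemma exists_dependency (F : fieldType) (T K : finType) (A : {set T})
    (C : {set K}) (w : T -> K -> F) (v : K -> F) (k0 : K) :
  (#|C| <= #|A|)%N -> k0 \in C -> v k0 != 0 ->
  {in A, forall a, \sum_(k in C) w a k * v k = 0} ->
  exists2 z : T -> F, exists2 a, a \in A & z a != 0 &
    {in C, forall k, \sum_(a in A) z a * w a k = 0}.
Proof.
move=> leCA k0C vk0 wv0.
pose N : 'M[F]_(#|A|, #|C|) := \matrix_(p, q) w (enum_val p) (enum_val q).
pose vv : 'cV[F]_#|C| := \col_q v (enum_val q).
have Nv0 : N *m vv = 0.
  apply/colP => p; rewrite !mxE -[RHS](wv0 _ (enum_valP p)).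
  rewrite [RHS]big_enum_val /=.
  by apply: eq_bigr => q _; rewrite !mxE.
have rkN : (\rank N < #|C|)%N.
  rewrite ltn_neqAle rank_leq_col andbT; apply/negP => /row_fullP[B BN].
  have : vv = 0 by rewrite -[vv]mul1mx -BN -mulmxA Nv0 mulmx0.
  move/colP/(_ (enum_rank_in k0C k0)); rewrite !mxE enum_rankK_in // => /eqP.
  by rewrite (negbTE vk0).
have : kermx N != 0.
  by rewrite kermx_eq0 /row_free neq_ltn (leq_trans rkN leCA).
case/rowV0Pn => u /sub_kermxP uN0 u0.
pose z a := \sum_(p | enum_val p == a) u 0 p.
have zE p : z (enum_val p) = u 0 p.
  rewrite /z (big_pred1 p) // => q; exact: (inj_eq enum_val_inj).
exists z.
  have /rV0Pn[p up] := u0; exists (enum_val p); last by rewrite zE.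
  exact: enum_valP.
move=> k kC; rewrite [LHS]big_enum_val /=.
have := congr1 (fun M : 'rV_ _ => M 0 (enum_rank_in kC k)) uN0.
rewrite !mxE => E; rewrite -[RHS]E; apply: eq_bigr => q _.
by rewrite zE !mxE enum_rankK_in.
Qed.

(** * Row and column sums of a matrix supported on a set of arcs *)

(** A cell (i, j) lies on the row [inl i] and on the column [inr j];
    equivalently, the arc (i, j) joins the out-copy of i to the in-copy of j.
    *)
Definition on_line (T : finType) (k : T + T) (a : T * T) : bool :=
  match k with inl i => a.1 == i | inr j => a.2 == j end.

Definition line_sum (R : nzRingType) (T : finType) (x : T * T -> R)
    (k : T + T) :=
  \sum_(a | on_line k a) x a.

(** The edges of A are independent in the bipartite graph of out-copies and
    in-copies: A is a forest there. *)
Definition line_free (R : nzRingType) (T : finType) (A : {set T * T}) : Prop :=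
  forall z : T * T -> R, (forall a, a \notin A -> z a = 0) ->
    (forall k, line_sum z k = 0) -> forall a, z a = 0.

Lemma line_sum_supp (R : nzRingType) (T : finType) (A : {set T * T})
    (z : T * T -> R) k :
  (forall a, a \notin A -> z a = 0) ->
  line_sum z k = \sum_(a in A) z a * (on_line k a)%:R.
Proof.
move=> zA; rewrite /line_sum big_mkcond [RHS]big_mkcond; apply: eq_bigr => a _.
have [aA|/zA ->] := boolP (a \in A); last by rewrite if_same.
by case: (on_line k a); rewrite ?mulr1 ?mulr0.
Qed.

Lemma line_sumL (R : nzRingType) (T : finType) (x : T * T -> R) i :
  line_sum x (inl i) = \sum_j x (i, j).
Proof.
rewrite /line_sum (eq_bigr (fun a => x (a.1, a.2))); last by case.
rewrite (eq_bigl (fun a => pred1 i a.1 && xpredT a.2)); last first.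
  by move=> a; rewrite /= andbT.
by rewrite -(pair_big (pred1 i) xpredT (fun i j => x (i, j))) big_pred1_eq.
Qed.

Lemma line_sumR (R : nzRingType) (T : finType) (x : T * T -> R) j :
  line_sum x (inr j) = \sum_i x (i, j).
Proof.
rewrite /line_sum.
rewrite (eq_bigr (fun a => x (a.1, a.2))); last by case.
rewrite -(pair_big xpredT (pred1 j) (fun i j => x (i, j)))/=.
by apply: eq_bigr => i _; rewrite big_pred1_eq.
Qed.

Lemma sum_on_line (R : nzSemiRingType) (T : finType) (C : {set T + T})
    (f : T + T -> R) (a : T * T) :
  inl a.1 \in C -> inr a.2 \in C ->
  \sum_(k in C) (on_line k a)%:R * f k = f (inl a.1) + f (inr a.2).
Proof.
move=> a1C a2C; rewrite big_mkcond /= big_sumType /=; congr (_ + _).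
  rewrite (bigD1 a.1) //= a1C eqxx mul1r big1 ?addr0 // => i /negbTE ia.
  by rewrite eq_sym ia mul0r if_same.
rewrite (bigD1 a.2) //= a2C eqxx mul1r big1 ?addr0 // => i /negbTE ia.
by rewrite eq_sym ia mul0r if_same.
Qed.

(** The forest bound: the edges F inside C number at most #|C| - 1. The one
    missing dimension comes from the sum of all rows being equal to the sum of
    all columns. *)
Lemma line_free_card (R : fieldType) (T : finType) (A F : {set T * T})
    (C : {set T + T}) :
  line_free R A -> F \subset A -> C != finset.set0 ->
  (forall a, a \in F -> (inl a.1 \in C) && (inr a.2 \in C)) ->
  (#|F| < #|C|)%N.
Proof.
move=> Afree FA /set0Pn[k0 k0C] FC; rewrite ltnNge; apply/negP => leCF.
(* Rows minus columns: the relation between the line sums of a matrix. *)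
pose v (k : T + T) : R := if k is inl _ then 1 else -1.
have v0 : v k0 != 0 by case: k0 {k0C} => ? /=; rewrite ?oppr_eq0 oner_eq0.
have [|z [a aF za] zC] := exists_dependency
    (w := fun a k => (on_line k a)%:R) leCF k0C v0.
  by move=> a /FC /andP[a1 a2]; rewrite sum_on_line //= subrr.
pose z' b := if b \in F then z b else 0.
have z'F b : b \notin F -> z' b = 0 by rewrite /z' => /negbTE ->.
have /negP[] := za; rewrite -[z a](_ : z' a = _); last by rewrite /z' aF.
apply/eqP; apply: Afree => [b bA|k].
  by apply: z'F; apply: contraNN bA; exact: (fintype.subsetP FA).
rewrite (line_sum_supp k z'F); have [kC|kC] := boolP (k \in C).
  by rewrite -[RHS](zC k kC); apply: eq_bigr => b bF; rewrite /z' bF.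
apply: big1 => b bF; have /andP[b1 b2] := FC _ bF.
case: k kC => i iC /=; rewrite [_ == i](_ : _ = false) ?mulr0 //.
  by apply: contraNF iC => /eqP <-.
by apply: contraNF iC => /eqP <-.
Qed.

(** Each line carrying a fractional cell carries a second one, since a line
    with sum 1 whose other cells are 0 or 1 has no fractional cell. As every
    cell is on two lines, the fractional cells would be at least as many as
    the lines they meet, against [line_free_card]. *)
Lemma line_free_integral (R : realFieldType) (T : finType) (A : {set T * T})
    (x : T * T -> R) :
  line_free R A -> (forall a, a \notin A -> x a = 0) -> (forall a, 0 <= x a) ->
  (forall k, line_sum x k = 1) -> forall a, x a = 0 \/ x a = 1.
Proof.
move=> Afree xA x0 x1 a.
pose F := [set a | (x a != 0) && (x a != 1)].
pose C := [set k | [exists a in F, on_line k a]].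
suff F0 : F = finset.set0.
  have : a \notin F by rewrite F0 inE.
  by rewrite inE negb_and !negbK => /orP[] /eqP; [left|right].
apply/eqP; apply/negPn/negP => /set0Pn[b bF].
have FC c : c \in F -> (inl c.1 \in C) && (inr c.2 \in C).
  by move=> cF; rewrite !inE; apply/andP; split; apply/existsP; exists c;
    rewrite cF /=.
have /(line_free_card Afree) : F \subset A.
  apply/fintype.subsetP => c; rewrite inE => /andP[+ _].
  by apply: contraNT => /xA ->.
move=> /(_ C) /(_ _)/(_ FC); have C0 : C != finset.set0.
  by apply/set0Pn; exists (inl b.1); case/andP: (FC b bF).
move=> /(_ C0); rewrite ltnNge => /negP; apply.
rewrite -(leq_pmul2l (isT : (0 < 2)%N)).
(* Count the pairs of a cell of F and a line through it. *)
have -> : (2 * #|F| = \sum_(k in C) #|[set a in F | on_line k a]|)%N.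
  under eq_bigr => k _ do rewrite -sum1_card big_mkcond.
  rewrite exchange_big /= -sum1_card big_distrr /= big_mkcond.
  apply: eq_bigr => d _.
  have [dF|dF] := boolP (d \in F); last first.
    by rewrite big1 // => k _; rewrite inE (negbTE dF).
  have /andP[dl dr] := FC d dF.
  rewrite -[LHS](sum_on_line (R := nat) (fun=> 1%N) dl dr).
  by apply: eq_bigr => k _; rewrite inE dF; case: (on_line k d).
rewrite mulnC -sum_nat_const; apply: leq_sum => k; rewrite inE.
case/existsP => c /andP[cF kc].
(* Suppose that c is the only fractional cell on the line k. *)
rewrite (cardD1 c) inE cF kc /= add1n ltnS lt0n; apply/negP => /eqP/card0_eq nF.
have others d : on_line k d -> d != c -> x d = 0 \/ x d = 1.
  move=> kd dc; have := nF d; rewrite !inE dc kd /= andbT => /negbT.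
  by rewrite negb_and !negbK => /orP[] /eqP; [left|right].
move: (cF); rewrite inE => /andP[c0 c1].
have := x1 k; rewrite /line_sum (bigD1 c) //=.
have [/existsP[d /and3P[kd dc /eqP xd]]|] :=
    boolP [exists d, [&& on_line k d, d != c & x d == 1]].
  rewrite (bigD1 d) ?kd //= xd => E.
  have s0 : 0 <= \sum_(i | on_line k i && (i != c) && (i != d)) x i.
    by apply: sumr_ge0.
  have := x0 c; rewrite le_eqVlt eq_sym (negbTE c0) /= => xc; lra.
rewrite negb_exists => /forallP no1; rewrite big1 ?addr0; first exact/eqP.
move=> d /andP[kd dc]; have [//|xd] := others d kd dc.
by have := no1 d; rewrite kd dc xd eqxx.
Qed.

(** Applied to the sums of x, all close to 1, the left inverse given by
    independence yields a vector close to s, its value on the constant 1. *)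
Lemma line_free_recovery (R : realFieldType) (T : finType) (A : {set T * T}) :
  line_free R A ->
  exists (s : T * T -> R) (K : R), forall (x : T * T -> R) (e : R),
    (forall a, a \notin A -> x a = 0) ->
    (forall k, `|line_sum x k - 1| <= e) -> forall a, `|x a - s a| <= K * e.
Proof.
move=> Afree.
have [|c cP] := @free_family_coordinates R _ _ A (fun a k => (on_line k a)%:R).
  move=> z z0 a aA; pose z' b := if b \in A then z b else 0.
  have z'A b : b \notin A -> z' b = 0 by rewrite /z' => /negbTE ->.
  rewrite -[z a](_ : z' a = _); last by rewrite /z' aA.
  apply: Afree => // k; rewrite (line_sum_supp k z'A) -[RHS](z0 k).
  by apply: eq_bigr => b bA; rewrite /z' bA.
exists (fun a => if a \in A then \sum_k c a k else 0).
exists (\sum_a \sum_k `|c a k|) => x e xA xe a.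
have K0 : 0 <= \sum_a \sum_k `|c a k|.
  by apply: sumr_ge0 => ? _; exact: sumr_ge0.
have e0 : 0 <= e by exact: le_trans (xe (inl a.1)).
case: ifPn => [aA|/xA ->]; last by rewrite subrr normr0 mulr_ge0.
rewrite (cP x a aA) -sumrB.
rewrite (le_trans (ler_norm_sum _ _ _)) //.
rewrite (@le_trans _ _ (\sum_k `|c a k| * e)) //.
  apply: ler_sum => k _; rewrite -{2}[c a k]mulr1 -mulrBr normrM ler_wpM2l //.
  by rewrite -(line_sum_supp k xA).
rewrite -mulr_suml ler_wpM2r // [leRHS](bigD1 a) //= lerDl.
by apply: sumr_ge0 => ? _; exact: sumr_ge0.
Qed.

(** * From permutations to disjoint cycles *)

Lemma zero_one_line_unique (R : realFieldType) (T : finType)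
    (s : T * T -> R) k :
  (forall a, s a = 0 \/ s a = 1) -> line_sum s k = 1 ->
  exists2 a, on_line k a && (s a == 1) &
    forall c, on_line k c -> s c = 1 -> c = a.
Proof.
move=> s01 sk.
have [a /andP[ka sa]|none] := pickP (fun a => on_line k a && (s a == 1));
    last first.
  move: sk; rewrite /line_sum big1 => [/eqP|a ka].
    by rewrite eq_sym oner_eq0.
  by have [//|sa] := s01 a; have := none a; rewrite ka sa eqxx.
exists a => [|c kc sc]; first by rewrite ka.
apply/eqP/negPn/negP => ca; move: sk.
rewrite /line_sum (bigD1 a) //= (bigD1 c) ?kc //= (eqP sa) sc => E.
have : 0 <= \sum_(i | on_line k i && (i != a) && (i != c)) s i.
  by apply: sumr_ge0 => i _; case: (s01 i) => ->.
by lra.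
Qed.

Lemma zero_one_permutation (R : realFieldType) (T : finType) (s : T * T -> R) :
  (forall a, s a = 0 \/ s a = 1) -> (forall k, line_sum s k = 1) ->
  exists2 f : T -> T, injective f & forall u v, s (u, v) = 1 <-> f u = v.
Proof.
move=> s01 s1; pose f u := odflt u [pick v | s (u, v) == 1].
have fP u v : s (u, v) = 1 <-> f u = v.
  have [a /andP[/eqP au sa] ua] := zero_one_line_unique s01 (s1 (inl u)).
  have ufu : s (u, f u) = 1.
    rewrite /f; case: pickP => [w /eqP//|/(_ a.2)].
    by rewrite -au -surjective_pairing sa.
  split=> [suv|<- //].
  have ua' w : s (u, w) = 1 -> (u, w) = a by apply: ua; rewrite /= eqxx.
  by have := ua' _ suv; rewrite -(ua' _ ufu) => -[].
exists f => // u v fuv.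
have [a _ ua] := zero_one_line_unique s01 (s1 (inr (f u))).
have ua' w : f w = f u -> (w, f u) = a.
  by move=> wu; apply: ua; rewrite /= ?eqxx //; exact/fP.
by have := ua' _ (erefl (f u)); rewrite -(ua' _ (esym fuv)) => -[].
Qed.

Lemma uniq_flatten_orbits (T : finType) (f : T -> T) (rs : seq T) :
  injective f -> uniq rs -> {in rs &, injective (froot f)} ->
  uniq (flatten [seq orbit f r | r <- rs]).
Proof.
move=> finj; elim: rs => [|r rs IH] //= /andP[rrs urs] injrs.
rewrite cat_uniq orbit_uniq IH // ?andbT; last first.
  by move=> u v urs' vrs; apply: injrs; rewrite inE ?urs' ?vrs orbT.
apply/hasPn => v /flatten_mapP[s srs].
rewrite -!fconnect_orbit => /(fingraph.rootP (fconnect_sym finj)) sv.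
apply: contra rrs => /(fingraph.rootP (fconnect_sym finj)) rv.
by rewrite (injrs r s) ?inE ?eqxx ?srs ?orbT // rv sv.
Qed.

(** The cycles are the orbits, one for each root; they have at least two nodes
    because f has no fixed point. *)
Lemma injection_spanning_cycles (T : finType) (f : T -> T) :
  injective f -> (forall v, f v != v) ->
  spanning_disjoint_cycles [set (v, f v) | v in T].
Proof.
move=> finj fneq.
pose rs := enum (froots f).
have rsP v : froot f v \in rs.
  by rewrite mem_enum; exact: roots_root (fconnect_sym finj) v.
have rsroot r : r \in rs -> froot f r = r by rewrite mem_enum => /eqP.
have cover v : v \in orbit f (froot f v).
  by rewrite -fconnect_orbit (fconnect_sym finj) connect_root.
exists [seq orbit f r | r <- rs]; split.
- apply/allP => c /mapP[r _ ->]; rewrite ltnNge; apply/negP => sz1.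
  have := fneq r; have := mem_orbit (in_orbit f r); have := in_orbit f r.
  case: (orbit f r) sz1 => [|s [|//]] //= _; rewrite !inE => /eqP -> /eqP ->.
  by rewrite eqxx.
- apply: uniq_flatten_orbits => //; first exact: enum_uniq.
  by move=> u v /rsroot {2}<- /rsroot {2}<-.
- by move=> v; apply/flatten_mapP; exists (froot f v).
- have nextE r v : v \in orbit f r -> next (orbit f r) v = f v.
    by move=> vr; have /eqP := next_cycle (cycle_orbit finj r) vr.
  rewrite big_map; apply/setP => -[u w].
  apply/imsetP/idP => [[v _ ->]|].
    rewrite (bigD1_seq (froot f v)) ?rsP ?enum_uniq //= inE; apply/orP; left.
    by apply/imsetP; exists v => //; rewrite nextE.
  elim/big_ind: _ => [|S S' HS HS'|r _]; first by rewrite inE.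
    by rewrite inE => /orP[/HS|/HS'].
  by case/imsetP => v vr [-> ->]; exists v => //; rewrite nextE.
Qed.

(** * Basis matrices and basic solutions *)

Lemma unitmx_castmx_bijective (F : fieldType) (m p : nat) (sz : p = m)
    (M : 'M[F]_(m, p)) :
  castmx (erefl, sz) M \in unitmx ->
  (forall v : 'cV_p, M *m v = 0 -> v = 0) /\
  (forall r : 'cV_m, exists v : 'cV_p, M *m v = r).
Proof.
case: m / sz M => M; rewrite castmx_id => Mu; split=> [v Mv0|r].
  by rewrite -(mulKmx Mu v) Mv0 mulmx0.
by exists (invmx M *m r); rewrite mulKVmx.
Qed.

(** The columns of [basis_mx] are indexed by the ranks of the elements of A
    and Y; this passes from such coordinates back to functions on arcs or
    nodes. *)
Lemma col_enum_val (R : nzRingType) (T : finType) (A : {set T})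
    (v : 'cV[R]_#|A|) :
  exists2 z : T -> R, forall a, a \notin A -> z a = 0
    & v = \col_p z (enum_val p).
Proof.
exists (fun a => \sum_(p | enum_val p == a) v p 0) => [a aA|].
  by apply: big1 => p /eqP pa; rewrite -pa enum_valP in aA.
apply/colP => p; rewrite mxE (big_pred1 p) // => q.
exact: (inj_eq enum_val_inj).
Qed.

Section Basis.
Context {R : realType} {n' : nat}.
Local Notation n := n'.+1.
Local Notation V := 'I_n.
Implicit Types (G : rel V) (beta : R) (b : basis_data n').

Lemma basis_mx_mul beta (A : {set V * V}) (Y : {set V}) (x : V * V -> R)
    (y : V -> R) :
  (forall a, a \notin A -> x a = 0) -> (forall i, i \notin Y -> y i = 0) ->
  basis_mx beta A Y *m
    col_mx (\col_p x (enum_val p)) (\col_q y (enum_val q)) =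
  col_mx (\col_k (line_sum x (inl k) - beta * line_sum x (inr k)))
         (\col_k (line_sum x (inl k) - y k)).
Proof.
move=> xA yY.
have lineE k : line_sum x k =
    \sum_(p < #|A|) x (enum_val p) * (on_line k (enum_val p))%:R.
  by rewrite (line_sum_supp k xA) big_enum_val.
rewrite /basis_mx mul_block_col mul0mx addr0; congr col_mx; apply/colP => k.
  rewrite !mxE !lineE mulr_sumr -sumrB; apply: eq_bigr => p _; rewrite !mxE /=.
  by rewrite ![k == _]eq_sym; ring.
rewrite !mxE !lineE; congr (_ + _).
  by apply: eq_bigr => p _; rewrite !mxE /= eq_sym mulrC.
have [kY|kY] := boolP (k \in Y); last first.
  rewrite yY // oppr0 big1 // => q _; rewrite !mxE.
  by case: eqP kY => [->|]; rewrite ?enum_valP // oppr0 mul0r.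
rewrite (bigD1 (enum_rank_in kY k)) //= !mxE enum_rankK_in // eqxx mulN1r.
rewrite big1 ?addr0 // => q qk; rewrite !mxE.
case: eqP => [kq|]; last by rewrite oppr0 mul0r.
by case/eqP: qk; apply: enum_val_inj; rewrite enum_rankK_in.
Qed.

Lemma out_sumE G (x : {ffun V * V -> R}) i :
  (forall u v, ~~ G u v -> x (u, v) = 0) -> out_sum G x i = line_sum x (inl i).
Proof.
move=> xG; rewrite line_sumL /out_sum big_mkcond; apply: eq_bigr => j _.
by case: ifPn => // /xG ->.
Qed.

Lemma in_sumE G (x : {ffun V * V -> R}) i :
  (forall u v, ~~ G u v -> x (u, v) = 0) -> in_sum G x i = line_sum x (inr i).
Proof.
move=> xG; rewrite line_sumR /in_sum big_mkcond; apply: eq_bigr => j _.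
by case: ifPn => // /xG ->.
Qed.

(** If all row and column sums of z vanish, then so do all combinations of
    them with weights 1 and -beta: (z, 0) is in the kernel of the basis
    matrix. *)
Lemma basis_line_free G beta b : is_basis G beta b -> line_free R (basicA b).
Proof.
case=> _ _ _ _ [sz /unitmx_castmx_bijective[ker0 _]] z zA z0 a.
have := basis_mx_mul beta zA (y := fun=> 0) (fun i _ => erefl : 0 = 0 :> R)
  (Y := basicY b).
have -> : (\col_k (line_sum z (inl k) - beta * line_sum z (inr k)) : 'cV_n) = 0.
  by apply/colP => k; rewrite !mxE !z0 mulr0 subrr.
have -> : (\col_k (line_sum z (inl k) - 0) : 'cV_n) = 0.
  by apply/colP => k; rewrite !mxE !z0 subrr.
rewrite col_mx0 => /ker0/eqP; rewrite col_mx_eq0 => /andP[/eqP zcol _].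
have [aA|/zA//] := boolP (a \in basicA b).
have /colP/(_ (enum_rank_in aA a)) := zcol.
by rewrite !mxE enum_rankK_in.
Qed.

(** [basic_solution] is a choice with default value 0, so what has to be shown
    is that a basic solution exists: the y-variables at their upper bound go
    to the right-hand side and the remaining square system is solvable. *)
Lemma basic_solutionP G beta b :
  is_basis G beta b -> is_basic_solution G beta b (basic_solution G beta b).
Proof.
move=> bP; apply: xgetPex; case: bP => AG Y0 LU dLU [sz].
move=> /unitmx_castmx_bijective[_ /(_ (col_mx
  (\col_k (if k == ord0 then 1 - beta ^+ n else 0))
  (\col_k (if k == ord0 then 1
           else beta ^+ n.-1 + (beta - beta ^+ n.-1) *+ (k \in atU b)))))[v]].
rewrite -[v]vsubmxK.
have [z zA ->] := col_enum_val (usubmx v).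
have [w wY ->] := col_enum_val (dsubmx v).
rewrite basis_mx_mul // => /eq_col_mx[/colP top /colP bot].
have notY0 : ord0 \notin basicY b.
  by apply/negP => /(fintype.subsetP Y0); rewrite !inE eqxx.
have LUP i :
    (i \in atL b) || (i \in atU b) = (i != ord0) && (i \notin basicY b).
  by have /setP/(_ i) := LU; rewrite !inE negb_or.
have U0 : ord0 \notin atU b.
  by have := LUP ord0; rewrite eqxx /= => /negbT; rewrite negb_or => /andP[].
have LnU i : i \in atL b -> i \notin atU b.
  by move=> iL; rewrite (disjointFr dLU iL).
pose x : {ffun V * V -> R} := [ffun a => z a].
pose y : {ffun V -> R} :=
  [ffun i => w i + (beta - beta ^+ n.-1) *+ (i \in atU b)].
have xA a : a \notin basicA b -> x a = 0 by move=> /zA; rewrite ffunE.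
have xG i j : ~~ G i j -> x (i, j) = 0.
  by move=> Gij; apply: xA; apply: contraNN Gij => /AG.
have xz k : line_sum x k = line_sum z k by apply: eq_bigr => a _; rewrite ffunE.
have {}top k : line_sum z (inl k) - beta * line_sum z (inr k) =
    if k == ord0 then 1 - beta ^+ n else 0 by have := top k; rewrite !mxE.
have {}bot k : line_sum z (inl k) - w k =
    if k == ord0 then 1
    else beta ^+ n.-1 + (beta - beta ^+ n.-1) *+ (k \in atU b).
  by have := bot k; rewrite !mxE.
exists (x, y); split => //=.
- split.
  + by rewrite out_sumE // in_sumE // !xz top eqxx.
  + by move=> i /negbTE i0; rewrite out_sumE // in_sumE // !xz top i0.
  + by have := bot ord0; rewrite wY // subr0 eqxx out_sumE // xz.
  + move=> i /negbTE i0; rewrite out_sumE // xz ffunE.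
    by have := bot i; rewrite i0 opprD addrA => ->; rewrite addrK.
- move=> i; rewrite ffunE !inE => /predU1P[->|iL].
    by rewrite wY // (negbTE U0) addr0.
  rewrite (negbTE (LnU i iL)) addr0 wY //.
  by have := LUP i; rewrite iL => /esym/andP[].
- move=> i iU; rewrite ffunE iU wY ?add0r //.
  by have := LUP i; rewrite iU orbT => /esym/andP[].
Qed.

End Basis.

(** * First-order estimates *)

Lemma expr1B_ge (R : realFieldType) (d : R) (k : nat) :
  0 <= d <= 1 -> 1 - k%:R * d <= (1 - d) ^+ k.
Proof.
move=> /andP[d0 d1]; elim: k => [|k IH]; first by rewrite mul0r subr0 expr0.
have := ler_wpM2r (_ : 0 <= 1 - d) IH; rewrite subr_ge0 => /(_ d1).
rewrite -exprSr; apply: le_trans; rewrite -natr1.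
by have := mulr_ge0 (ler0n R k) (mulr_ge0 d0 d0); nra.
Qed.

Lemma expr1B_le (R : realFieldType) (d : R) (k : nat) :
  0 <= d <= 1 -> (1 - d) ^+ k <= 1 - k%:R * d + k%:R ^+ 2 * d ^+ 2.
Proof.
move=> /andP[d0 d1]; elim: k => [|k IH]; first by rewrite !mul0r expr0; lra.
have := ler_wpM2r (_ : 0 <= 1 - d) IH; rewrite subr_ge0 => /(_ d1).
rewrite -exprSr => /le_trans; apply; rewrite -natr1.
have k0 := ler0n R k; have dd := mulr_ge0 d0 d0.
have := mulr_ge0 k0 dd; have := mulr_ge0 (mulr_ge0 k0 k0) (mulr_ge0 d0 dd).
nra.
Qed.

Lemma le_of_linear_error (R : realFieldType) (e K u v : R) :
  0 < e -> (forall d : R, 0 < d <= e -> u <= v + K * d) -> u <= v.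
Proof.
move=> e0 uv; apply/ler_addgt0Pr => t t0.
have K1 : 0 < `|K| + 1 by rewrite ltr_wpDl.
pose d := Num.min e (t / (`|K| + 1)).
have d0 : 0 < d by rewrite lt_min e0 divr_gt0.
apply: le_trans (uv d _) _; first by rewrite d0 ge_min lexx.
have : d <= t / (`|K| + 1) by rewrite ge_min lexx orbT.
rewrite ler_pdivlMr // => dt; rewrite lerD2l; apply: le_trans dt.
by rewrite mulrC ler_pM2l // (le_trans (ler_norm K)) // lerDl.
Qed.

Lemma sum_nat_ord (R : realFieldType) (m : nat) :
  \sum_(k < m) (k%:R : R) = m%:R * (m%:R - 1) / 2.
Proof.
elim: m => [|m IH]; first by rewrite big_ord0 !mul0r.
by rewrite big_ord_recr /= IH -natr1; field.
Qed.

(** (1-d) - (1-d)^m is (m-1)d to first order; dividing by d and letting d tend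
    to 0 leaves c (m-1) <= m (m-1) / 2. *)
Lemma slack_count (R : realFieldType) (c e C : R) (m : nat) :
  (1 < m)%N -> 0 <= c -> 0 < e <= 1 ->
  (forall d : R, 0 < d <= e ->
     c * ((1 - d) - (1 - d) ^+ m) <=
     d * (m%:R * (m%:R - 1) / 2) + C * d ^+ 2) ->
  c <= m%:R / 2.
Proof.
move=> m1 c0 /andP[e0 e1] H.
have m1R : 0 < m%:R - 1 :> R by rewrite subr_gt0 ltr1n.
rewrite -(ler_pM2r m1R).
apply: (le_of_linear_error (K := C + c * m%:R ^+ 2) e0) => d dP.
have /andP[d0 de] := dP; have d01 : 0 <= d <= 1.
  by rewrite (ltW d0) (le_trans de e1).
rewrite -(ler_pM2r d0); have := H d dP; have := ler_wpM2l c0 (expr1B_le m d01).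
set p := (1 - d) ^+ m; set M := m%:R; move=> H1 H2; nra.
Qed.

(** * Flow at a feasible basis *)

Section Ultimate.
Context {R : realType} {n' : nat}.
Local Notation n := n'.+1.
Local Notation V := 'I_n.
Implicit Types (G : rel V) (beta : R) (b : basis_data n').

(** The constraints, with the sums over the arcs of G replaced by sums over
    all pairs of nodes, which is the same as x vanishes outside A. *)
Lemma feasible_flow G beta b (x := (basic_solution G beta b).1) :
  feasible_bases G beta b ->
  [/\ forall a, a \notin basicA b -> x a = 0,
      forall a, 0 <= x a,
      line_sum x (inl ord0) = 1,
      forall i, i != ord0 -> beta ^+ n' <= line_sum x (inl i) <= beta
    & forall i, line_sum x (inl i) - beta * line_sum x (inr i) =
                (if i == ord0 then 1 - beta ^+ n else 0)].
Proof.
case=> bP; have [[e1 e2 e3 e4] xA _ _] := basic_solutionP bP.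
rewrite -/x in e1 e2 e3 e4 xA *; case=> ybd xpos.
have xG i j : ~~ G i j -> x (i, j) = 0.
  by move=> Gij; apply: xA; apply: contraNN Gij; case: bP => AG _ _ _ _ /AG.
split => //.
- by move=> [i j]; have [/xpos//|/xG ->] := boolP (G i j).
- by rewrite -(out_sumE ord0 xG).
- move=> i i0; rewrite -(out_sumE i xG); have := e4 i i0; have := ybd i i0.
  by rewrite /= => /andP[y0 y1] E; rewrite -E in y1 *; apply/andP; split; lra.
- move=> i; rewrite -(out_sumE i xG) -(in_sumE i xG).
  by case: eqP => [->|/eqP /e2].
Qed.

Lemma feasible_bound_sums G beta b (x := (basic_solution G beta b).1) :
  feasible_bases G beta b ->
  (forall i, i \in atL b -> line_sum x (inl i) = beta ^+ n') /\
  (forall i, i \in atU b -> line_sum x (inl i) = beta).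
Proof.
case=> bP _; have [[_ _ _ e4] xA yL yU] := basic_solutionP bP.
rewrite -/x in e4 xA yL yU *.
have [AG Y0 LU _ _] := bP.
have xG i j : ~~ G i j -> x (i, j) = 0.
  by move=> Gij; apply: xA; apply: contraNN Gij => /AG.
have LU0 i : (i \in atL b) || (i \in atU b) -> i != ord0.
  have /setP/(_ i) := LU; rewrite !inE negb_or => ->; by case/andP.
split=> i iP; rewrite -(out_sumE i xG).
  have := e4 i (LU0 i _); rewrite iP => /(_ isT).
  by rewrite yL ?subr0 // inE iP orbT.
have := e4 i (LU0 i _); rewrite iP orbT => /(_ isT).
by rewrite yU //= => E; lra.
Qed.

(** For inflows this follows by conservation: the inflow of a node other than
    1 is its outflow divided by beta, and the inflow of node 1 is exactly
    beta^(n-1). *)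
Lemma feasible_line_sums G beta b k (x := (basic_solution G beta b).1) :
  0 < beta < 1 -> feasible_bases G beta b ->
  beta ^+ n' <= line_sum x k <= 1.
Proof.
move=> b01 fb; have [_ _ out0 outi cons] := feasible_flow fb.
rewrite -/x in out0 outi cons *; have /andP[b0 b1] := b01.
have bn1 : beta ^+ n' <= 1 by rewrite exprn_ile1 // ltW.
have bn0 : 0 <= beta ^+ n' by rewrite exprn_ge0 // ltW.
have outb i : beta ^+ n' <= line_sum x (inl i) <= 1.
  have [->|/outi/andP[-> h]] := eqVneq i ord0; first by rewrite out0 bn1 lexx.
  by rewrite (le_trans h) // ltW.
case: k => i; first exact: outb.
have := cons i; have [-> E|i0 E] := eqVneq i ord0.
  suff -> : line_sum x (inr ord0) = beta ^+ n' by rewrite lexx bn1.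
  apply: (mulfI (lt0r_neq0 b0)); rewrite -exprS.
  by move: E; rewrite out0; lra.
have /andP[h1 h2] := outi i i0.
rewrite -(ler_pM2l b0) -(ler_pM2l b0 _ 1) mulr1.
by apply/andP; split; nra.
Qed.

(** Total outflow equals total inflow, so adding up the conservation equations
    gives (1 - beta) T = 1 - beta^n for the total T, a geometric sum whose
    first term is the outflow of node 1. *)
Lemma feasible_total G beta b (x := (basic_solution G beta b).1) :
  0 < beta < 1 -> feasible_bases G beta b ->
  \sum_(i | i != ord0) line_sum x (inl i) = \sum_(k < n') beta ^+ k.+1.
Proof.
move=> b01 fb; have [_ _ out0 outi cons] := feasible_flow fb.
rewrite -/x in out0 outi cons *; have /andP[b0 b1] := b01.
have total : \sum_i line_sum x (inl i) = \sum_i line_sum x (inr i).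
  under eq_bigr => i _ do rewrite line_sumL.
  by rewrite exchange_big; apply: eq_bigr => i _; rewrite line_sumR.
have : \sum_i (line_sum x (inl i) - beta * line_sum x (inr i)) = 1 - beta ^+ n.
  rewrite (eq_bigr _ (fun i _ => cons i)) (bigD1 ord0) //= big1 ?addr0 //.
  by move=> i /negbTE ->.
rewrite sumrB -mulr_sumr -total -[1 - _]opprB subrX1 -[RHS]mulNr opprB.
rewrite -{1}[\sum_i line_sum x _]mul1r -mulrBl.
have /mulfI/[apply] : 1 - beta != 0 by rewrite subr_eq0 gt_eqF.
rewrite (bigD1 ord0) //= out0 big_ord_recl /= expr0 => /addrI ->.
by apply: eq_bigr => k _.
Qed.

(** No arc of A enters the set Z of unreachable nodes from outside, so the
    inflow of Z is at most its outflow; conservation multiplies the inflow by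
    beta < 1, which would make the positive outflow of Z vanish. *)
Lemma feasible_reach G beta b i :
  0 < beta < 1 -> feasible_bases G beta b ->
  connect [rel u v | (u, v) \in basicA b] ord0 i.
Proof.
move=> b01 fb; have [xA xpos out0 outi cons] := feasible_flow fb.
set x := (basic_solution G beta b).1 in xA xpos out0 outi cons.
have /andP[b0 b1] := b01; set e := [rel u v | _].
apply/negPn/negP => ni; pose Z := [pred v | ~~ connect e ord0 v].
have Z0 v : v \in Z -> v != ord0.
  by rewrite inE; apply: contraNneq => ->; exact: connect0.
pose S := \sum_(v in Z) line_sum x (inl v).
have S0 : 0 < S.
  have iZ : i \in Z by rewrite inE.
  rewrite /S (bigD1 i) //= ltr_pwDl //.
    have /andP[+ _] := outi i (Z0 i iZ); apply: lt_le_trans.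
    by rewrite exprn_gt0.
  by apply: sumr_ge0 => v _; apply: sumr_ge0.
have inZ : \sum_(v in Z) line_sum x (inr v) <= S.
  have -> : \sum_(v in Z) line_sum x (inr v) =
      \sum_(u in Z) \sum_(v in Z) x (u, v).
    rewrite exchange_big /=; apply: eq_bigr => v; rewrite inE => vZ.
    rewrite line_sumR [RHS]big_mkcond; apply: eq_bigr => u _.
    case: ifPn => //; rewrite inE negbK => u0; apply: xA.
    by apply: contraNN vZ => uv; apply: connect_trans u0 (connect1 _).
  apply: ler_sum => u _; rewrite line_sumL [leLHS]big_mkcond.
  by apply: ler_sum => v _; case: ifP.
have : S = beta * \sum_(v in Z) line_sum x (inr v).
  rewrite mulr_sumr; apply: eq_bigr => v /Z0/negbTE v0.
  by have := cons v; rewrite v0 => /eqP; rewrite subr_eq0 => /eqP.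
nra.
Qed.

(** * The limit of the basic solution *)

Lemma ultimate_feasible G b : ultimate_bases R G b ->
  exists2 e : R, 0 < e <= 1 & forall d : R, 0 < d <= e ->
    0 < 1 - d < 1 /\ feasible_bases G (1 - d) b.
Proof.
case=> alpha [/andP[a0 a1] stab] fb; exists (1 - alpha).
  by apply/andP; split; lra.
move=> d /andP[d0 d1]; split; first by apply/andP; split; lra.
by rewrite stab //; apply/andP; split; lra.
Qed.

(** Every sum of x(1 - d) lies between (1 - d)^(n-1) >= 1 - (n-1) d and 1,
    which gives the rate; the signs and the sums of the limit follow from
    those of x(1 - d), and it is 0/1 by [line_free_integral]. *)
Lemma ultimate_limit G b : ultimate_bases R G b ->
  exists (s : V * V -> R) (K e : R),
  [/\ 0 < e, forall d : R, 0 < d <= e ->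
        forall a, `|(basic_solution G (1 - d) b).1 a - s a| <= K * d,
      forall a, a \notin basicA b -> s a = 0,
      forall a, s a = 0 \/ s a = 1
    & forall k, line_sum s k = 1].
Proof.
move=> ub; have [e /andP[e0 e1] fe] := ultimate_feasible ub.
have Afree : line_free R (basicA b).
  have [|_ [bP _]] := fe e; first by rewrite e0 lexx.
  exact: basis_line_free bP.
have [s [K sP]] := line_free_recovery Afree.
have close d : 0 < d <= e ->
    forall a, `|(basic_solution G (1 - d) b).1 a - s a| <= (K * n'%:R) * d.
  move=> de; have [d01 fd] := fe d de; have [xA _ _ _ _] := feasible_flow fd.
  move=> a; rewrite -mulrA; apply: sP => // k.
  have /andP[h1 h2] := feasible_line_sums k d01 fd.
  have /andP[d0 d1] := de; have : 0 <= d <= 1 by apply/andP; split; lra.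
  move/(expr1B_ge n') => h3; rewrite ler_norml; apply/andP; split; lra.
have sA a : a \notin basicA b -> s a = 0.
  move=> aA; apply/eqP; rewrite -normr_eq0 eq_le normr_ge0 andbT.
  apply: (le_of_linear_error (K := K * n'%:R) e0) => d de; rewrite add0r.
  have := close d de a.
  have [d01 fd] := fe d de; have [xA _ _ _ _] := feasible_flow fd.
  by rewrite xA // sub0r normrN.
have spos a : 0 <= s a.
  rewrite -oppr_le0.
  apply: (le_of_linear_error (K := K * n'%:R) e0) => d de; rewrite add0r.
  have [d01 fd] := fe d de; have [_ /(_ a) xa _ _ _] := feasible_flow fd.
  by have := close d de a; rewrite ler_norml => /andP[_]; lra.
have s1 k : line_sum s k = 1.
  apply/eqP; rewrite -subr_eq0 -normr_eq0 eq_le normr_ge0 andbT.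
  apply: (le_of_linear_error
    (K := n'%:R + \sum_(a | on_line k a) (K * n'%:R)) e0).
  move=> d de; rewrite add0r; have [d01 fd] := fe d de.
  set x := (basic_solution G (1 - d) b).1.
  rewrite -(subrKA (line_sum x k)) addrC (le_trans (ler_normD _ _)) // mulrDl.
  apply: lerD.
    have /andP[h1 h2] := feasible_line_sums k d01 fd.
    have /andP[d0 d1] := de; have : 0 <= d <= 1 by apply/andP; split; lra.
    by move/(expr1B_ge n') => h3; rewrite ler_norml; apply/andP; split; lra.
  rewrite -sumrB (le_trans (ler_norm_sum _ _ _)) // mulr_suml.
  by apply: ler_sum => a _; rewrite distrC; exact: close.
exists s, (K * n'%:R), e; split => //.
exact: line_free_integral Afree sA spos s1.
Qed.

Lemma near_limit_thick G b (s : V * V -> R) (K e : R) a :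
  0 < e -> (forall d : R, 0 < d <= e ->
    forall a, `|(basic_solution G (1 - d) b).1 a - s a| <= K * d) ->
  s a = 1 -> thick (R := R) G b a.
Proof.
move=> e0 close sa; exists K; near=> d.
have := close d _ a; rewrite sa; apply.
by apply/andP; split; near: d; [exact: nbhs_right_gt|exact: nbhs_right_le].
Unshelve. all: by end_near. Qed.

Lemma near_limit_thin G b (s : V * V -> R) (K e : R) a :
  0 < e -> (forall d : R, 0 < d <= e ->
    forall a, `|(basic_solution G (1 - d) b).1 a - s a| <= K * d) ->
  s a = 0 -> thin (R := R) G b a.
Proof.
move=> e0 close sa; exists K; near=> d.
have := close d _ a; rewrite sa subr0; apply.
by apply/andP; split; near: d; [exact: nbhs_right_gt|exact: nbhs_right_le].
Unshelve. all: by end_near. Qed.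

Lemma thin_not_thick G b a : thin (R := R) G b a -> ~ thick (R := R) G b a.
Proof.
move=> [C1 H1] [C2 H2].
near ((0 : R)^'+)%classic => d.
have h1 : `|(basic_solution G (1 - d) b).1 a| <= C1 * d by near: d.
have h2 : `|(basic_solution G (1 - d) b).1 a - 1| <= C2 * d by near: d.
have M0 : 0 < `|C1| + `|C2| + 1 by rewrite ltr_wpDl // addr_ge0.
have d0 : 0 < d by near: d; exact: nbhs_right_gt.
have : d < (`|C1| + `|C2| + 1)^-1.
  by near: d; apply: nbhs_right_lt; rewrite invr_gt0.
rewrite -[_^-1]mul1r ltr_pdivlMr // => dM.
have c1 := ler_norm C1; have c2 := ler_norm C2.
by move: h1 h2; rewrite !ler_norml => /andP[? ?] /andP[? ?]; nra.
Unshelve. all: by end_near. Qed.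

(** * Counting the nonbasic y-variables *)

(** By the forest bound #|A| < 2n, so Y is not empty, and one node other than
    node 1 is outside L and U. *)
Lemma basis_nonbasic_le G beta b : is_basis G beta b ->
  (#|atL b| <= n'.-1)%N /\ (#|atU b| <= n'.-1)%N.
Proof.
move=> bP; have Afree := basis_line_free bP; have [_ Y0 LU _ [sz _]] := bP.
have Y1 : (0 < #|basicY b|)%N.
  pose C := [set: (V + V)%type]%SET.
  have CT k : k \in C by rewrite finset.in_setT.
  have C0 : C != finset.set0 by apply/set0Pn; exists (inl ord0).
  have := line_free_card Afree (subxx (basicA b)) C0.
  have -> : #|C| = (#|basicA b| + #|basicY b|)%N.
    by rewrite finset.cardsT card_sum card_ord sz.
  rewrite -{1}[#|basicA b|]addn0 ltn_add2l; apply => a _.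
  by rewrite !CT.
have szLU : (#|atL b :|: atU b| <= n'.-1)%N.
  rewrite LU cardsCs finset.setCK card_ord cardsU1.
  have -> : ord0 \notin basicY b.
    by apply/negP => /(fintype.subsetP Y0); rewrite !inE eqxx.
  by rewrite add1n subSS -subn1 leq_sub2l.
split; apply: leq_trans szLU; apply: subset_leq_card.
  exact: finset.subsetUl.
exact: finset.subsetUr.
Qed.

(** The outflows of the nodes other than 1 add up to beta + ... + beta^(n-1),
    so to first order their shortfalls from beta add up to (0 + 1 + ... +
    (n-2)) delta; each node of L accounts for (n-2) delta. *)
Lemma ultimate_atL_le G b : ultimate_bases R G b ->
  #|atL b|%:R <= n'%:R / 2 :> R.
Proof.
move=> ub; have [e eP fe] := ultimate_feasible ub.
have [|_ [bP _]] := fe e; first by rewrite lexx andbT; case/andP: eP.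
have [Lle _] := basis_nonbasic_le bP.
have [n1|] := ltnP 1 n'; last first.
  move=> n1; have -> : #|atL b| = 0%N; last by rewrite divr_ge0.
  by apply/eqP; rewrite -leqn0 (leq_trans Lle) // -subn1 leq_subLR.
apply: (slack_count (C := 0) n1 _ eP) => // d de; have [d01 fd] := fe d de.
have [_ _ _ outi _] := feasible_flow fd.
have [outL _] := feasible_bound_sums fd.
have tot := feasible_total d01 fd.
set x := (basic_solution G (1 - d) b).1 in outi outL tot.
have LU0 i : i \in atL b -> i != ord0.
  case: bP => _ _ /setP/(_ i) + _ _ iL; rewrite !inE iL negb_or.
  by move/esym/andP => [].
have card0 : \sum_(i : V | i != ord0) (1 - d) = n'%:R * (1 - d).
  by rewrite sumr_const -[LHS]mulr_natl cardC1 card_ord.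
apply: (@le_trans _ _ (\sum_(i : V | i != ord0) (1 - d - line_sum x (inl i)))).
  rewrite mulr_natl -sumr_const big_mkcond [leRHS]big_mkcond.
  apply: ler_sum => i _; case: ifP => [iL|_].
    by rewrite (LU0 i iL) outL.
  by case: ifP => // /outi/andP[_]; rewrite subr_ge0.
rewrite sumrB card0 tot mul0r addr0 -sum_nat_ord mulr_sumr.
have -> : n'%:R * (1 - d) = \sum_(k < n') (1 - d).
  by rewrite sumr_const card_ord mulr_natl.
rewrite -sumrB; apply: ler_sum => k _.
have : 0 <= d <= 1 by case/andP: de; case/andP: eP => *; apply/andP; split; lra.
by move/(expr1B_ge k.+1); rewrite -natr1 /=; lra.
Qed.

(** As for L, with the excess of the outflows over the lower extreme
    beta^(n-1). *)
Lemma ultimate_atU_le G b : ultimate_bases R G b ->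
  #|atU b|%:R <= n'%:R / 2 :> R.
Proof.
move=> ub; have [e eP fe] := ultimate_feasible ub.
have [|_ [bP _]] := fe e; first by rewrite lexx andbT; case/andP: eP.
have [_ Ule] := basis_nonbasic_le bP.
have [n1|] := ltnP 1 n'; last first.
  move=> n1; have -> : #|atU b| = 0%N; last by rewrite divr_ge0.
  by apply/eqP; rewrite -leqn0 (leq_trans Ule) // -subn1 leq_subLR.
apply: (slack_count (C := n'%:R * n'%:R ^+ 2) n1 _ eP) => // d de.
have [d01 fd] := fe d de.
have [_ _ _ outi _] := feasible_flow fd.
have [_ outU] := feasible_bound_sums fd.
have tot := feasible_total d01 fd.
set x := (basic_solution G (1 - d) b).1 in outi outU tot.
have LU0 i : i \in atU b -> i != ord0.
  case: bP => _ _ /setP/(_ i) + _ _ iU; rewrite !inE iU orbT negb_or.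
  by move/esym/andP => [].
have card0 : \sum_(i : V | i != ord0) (1 - d) ^+ n' = n'%:R * (1 - d) ^+ n'.
  by rewrite sumr_const -[LHS]mulr_natl cardC1 card_ord.
apply: (@le_trans _ _ (\sum_(i : V | i != ord0)
    (line_sum x (inl i) - (1 - d) ^+ n'))).
  rewrite mulr_natl -sumr_const big_mkcond [leRHS]big_mkcond.
  apply: ler_sum => i _; case: ifP => [iU|_].
    by rewrite (LU0 i iU) outU.
  by case: ifP => // /outi/andP[+ _]; rewrite subr_ge0.
rewrite sumrB card0 tot.
have -> : n'%:R * (1 - d) ^+ n' = \sum_(k < n') (1 - d) ^+ n'.
  by rewrite sumr_const card_ord mulr_natl.
have -> : n'%:R * n'%:R ^+ 2 * d ^+ 2 = \sum_(k < n') n'%:R ^+ 2 * d ^+ 2.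
  by rewrite sumr_const card_ord -mulrA mulr_natl.
rewrite -sum_nat_ord [X in d * X](reindex_inj rev_ord_inj) mulr_sumr.
rewrite -big_split -sumrB.
have dP : 0 <= d <= 1.
  by case/andP: de; case/andP: eP => *; apply/andP; split; lra.
apply: ler_sum => k _ /=; have h1 := expr1B_ge n' dP.
have h2 := expr1B_le k.+1 dP.
have sq : (k.+1%:R : R) ^+ 2 * d ^+ 2 <= n'%:R ^+ 2 * d ^+ 2.
  by rewrite ler_wpM2r ?sqr_ge0 // ler_sqr ?nnegrE // ler_nat.
by rewrite natrB //; lra.
Qed.

End Ultimate.

(** * The structure of ultimate bases *)

Theorem theorem3p3 (R : realType) (n' : nat) (hn : (2 <= n'.+1)%N)
    (G : rel 'I_n'.+1) (loopless : irreflexive G)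
    (b : basis_data n') (hb : ultimate_bases R G b) :
  let A1 := thick_arcs R G b in
  let A2 := thin_arcs R G b in
  [/\ basicA b = A1 :|: A2,
      spanning_disjoint_cycles A1,
      forall i : 'I_n'.+1, i != ord0 ->
        connect [rel u v | (u, v) \in A1 :|: A2] ord0 i
    & (#|atL b|%:R <= (n'.+1 - 1)%:R / 2 :> R) /\
      (#|atU b|%:R <= (n'.+1 - 1)%:R / 2 :> R)].
Proof.
move=> A1 A2.
have [s [K [e [e0 close sA s01 s1]]]] := ultimate_limit hb.
have [f finj fP] := zero_one_permutation s01 s1.
have [e' e'P fe] := ultimate_feasible hb.
have [|d01 fd] := fe e'; first by case/andP: e'P => -> _; rewrite lexx.
have [AG _ _ _ _] := fd.1.
have inA a : s a = 1 -> a \in basicA b.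
  by move=> sa; apply/negPn/negP => /sA /eqP; rewrite sa oner_eq0.
have A1E a : a \in A1 <-> s a = 1.
  rewrite inE; split=> [/andP[_ /asboolP ta]|sa].
    have [sa|//] := s01 a.
    by case: (thin_not_thick (near_limit_thin e0 close sa) ta).
  by rewrite inA //; apply/asboolP; exact: near_limit_thick e0 close sa.
have AE : basicA b = A1 :|: A2.
  apply/setP => a; rewrite inE; apply/idP/orP => [aA|].
    have [sa|/A1E aA1] := s01 a; [right|by left].
    by rewrite inE aA; apply/asboolP; exact: near_limit_thin e0 close sa.
  by rewrite !inE => -[] /andP[].
split=> //.
- have -> : A1 = [set (v, f v) | v in 'I_n'.+1]%SET.
    apply/setP => -[u w]; apply/idP/imsetP => [/A1E/fP <-|[v _ ->]].
      by exists u.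
    exact/A1E/fP.
  apply: injection_spanning_cycles finj _ => v.
  apply: contraFneq (loopless v) => fv.
  by apply/AG/inA/fP.
- by move=> i _; rewrite -AE; exact: feasible_reach d01 fd.
- rewrite subn1; split; [exact: ultimate_atL_le hb|exact: ultimate_atU_le hb].
Qed.
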